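(* Let $P(z)$ be a polynomial with complex coefficients, let $n\in\{1,2,3,\dots\}$ be such that $n\ge\deg(P)$, and let $\omega=e^{i\pi/n}$. Then, for arbitrary complex numbers $z_0$ and $z$ with $z\ne 0$, and for every $j\in\{0,1,\dots,n\}$, $$\frac{P^{(j)}(z_0)}{j!}=\frac{1}{2n}\sum_{k=0}^{2n-1}\frac{P(\zeta_k)}{(\zeta_k-z_0)^j},\quad\text{where }\zeta_k=z_0+z\omega^k.$$
   Context: $P^{(j)}$ denotes the $j$-th derivative of $P$. *)

(* Defs.v *)
From mathcomp Require Export all_boot all_order all_algebra.
From mathcomp Require Export reals sequences exp trigo.
From mathcomp Require Export complex.

Set Implicit Arguments.
Unset Strict Implicit.
Unset Printing Implicit Defensive.

Import GRing.Theory.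
Local Open Scope ring_scope.
Local Open Scope complex_scope.

(* e^(x + i y) = e^x (cos y + i sin y); mathcomp-analysis only has the real
   exponential. *)
Definition cexp (R : realType) (w : R[i]) : R[i] :=
  (expR (complex.Re w))%:C * (cos (complex.Im w) +i* sin (complex.Im w)).

(* Main.v *)
Require Import Defs.
From mathcomp Require Import all_boot all_order all_algebra.
From mathcomp Require Import reals sequences exp trigo.
From mathcomp Require Import complex.

(** Taylor's formula at [z0] turns [P.[z0 + h]] into the sum over [m <= n] of
    [P^`N(m).[z0] * h ^+ m], where [P^`N(m)] is the [m]-th derivative divided
    by [m`!].  Dividing by [h ^+ j] and averaging over the points
    [h = z * w ^+ k], [k < N], with [w] an [N]-th root of unity, the term of
    index [m] is multiplied by the average of the powers of
    [w ^+ m / w ^+ j].  That ratio is again an [N]-th root of unity, so its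
    powers average to [0] unless it is [1], and only the term [m = j] survives
    provided that the powers [w ^+ m], [m <= n], are pairwise distinct
    (lemma [nderivn_root_of_unity_avg]).

    For [w = e ^ (i pi / n)] and [N = 2 n], distinctness is immediate: the
    angles [m pi / n], [m <= n], all lie in the interval from [0] to [pi], on
    which the cosine is injective.  This is why [2 n] points suffice for all
    orders [j <= n] simultaneously, the extreme orders [0] and [n] included:
    with the [n]-th roots of unity, these two would be confused. *)

Set Implicit Arguments.
Unset Strict Implicit.
Unset Printing Implicit Defensive.

Import Order.POrderTheory GRing.Theory Num.Theory.
Local Open Scope ring_scope.
Local Open Scope complex_scope.

Lemma sum_expr_root_of_unity (F : fieldType) (N : nat) (r : F) :
  r ^+ N = 1 -> \sum_(k < N) r ^+ k = if r == 1 then N%:R else 0.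
Proof.
move=> rN1; have [->|r_neq1] := eqVneq r 1.
  under eq_bigr do rewrite expr1n.
  by rewrite sumr_const card_ord.
have := subrX1 r N; rewrite rN1 subrr => /esym/eqP.
by rewrite mulf_eq0 subr_eq0 (negPf r_neq1) => /eqP.
Qed.

(** Discrete Cauchy formula: the [N] sample points need not separate all
    residues modulo [N], only the exponents that can occur in [P]. *)
Lemma nderivn_root_of_unity_avg (F : fieldType) (P : {poly F}) (n N : nat)
    (w z0 z : F) (j : nat) :
    N%:R != 0 :> F -> w ^+ N = 1 ->
    {in [pred m | (m <= n)%N] &, injective (fun m => w ^+ m)} ->
    (size P <= n.+1)%N -> z != 0 -> (j <= n)%N ->
  P^`N(j).[z0] =
    N%:R^-1 * \sum_(k < N) P.[z0 + z * w ^+ k] / (z * w ^+ k) ^+ j.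
Proof.
move=> N_neq0 wN1 w_inj degP z_neq0 j_le_n.
have w_neq0 : w != 0.
  apply: contraNneq N_neq0 => w0; move: wN1; rewrite w0.
  by case: N => [|N] // /eqP; rewrite expr0n eq_sym oner_eq0.
have sampleE (k : 'I_N) : P.[z0 + z * w ^+ k] / (z * w ^+ k) ^+ j =
    \sum_(m < n.+1) P^`N(m).[z0] * (z ^+ m / z ^+ j) * (w ^+ m / w ^+ j) ^+ k.
  rewrite (nderiv_taylor_wide (mulrC _ _) degP) mulr_suml.
  apply: eq_bigr => m _; rewrite !exprMn exprVn -!exprM invfM.
  by rewrite ![(_ * k)%N]mulnC -!mulrA; congr (_ * (_ * _)); rewrite mulrCA.
rewrite (eq_bigr _ (fun k _ => sampleE k)) exchange_big /=.
have j_lt : (j < n.+1)%N by [].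
rewrite (bigD1 (Ordinal j_lt)) //= [X in _ * (_ + X)]big1 => [|m m_neqj].
  rewrite addr0 -mulr_sumr !divff ?expf_neq0 // mulr1.
  rewrite sum_expr_root_of_unity ?expr1n // eqxx.
  by rewrite mulrC mulfK.
rewrite -mulr_sumr sum_expr_root_of_unity; last first.
  by rewrite exprMn exprVn -!exprM ![(_ * N)%N]mulnC !exprM wN1 !expr1n divr1.
case: eqP => [ratio1|_]; last by rewrite mulr0.
case/eqP: m_neqj; apply/val_inj/w_inj; rewrite ?inE -1?ltnS //=.
exact: divr1_eq ratio1.
Qed.

Lemma cexpi_expr (R : realType) (t : R) (k : nat) :
  cexp (0 +i* t) ^+ k = cos (t *+ k) +i* sin (t *+ k).
Proof.
have cexpiE u : cexp (0 +i* u) = cos u +i* sin u.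
  by rewrite /cexp /= expR0 mul1r.
elim: k => [|k IHk]; first by rewrite !mulr0n cos0 sin0.
rewrite exprS IHk cexpiE mulrS cosD sinD.
by apply/eqP; rewrite eq_complex /= eqxx addrC [cos t * _]mulrC mulrC eqxx.
Qed.

(** The exponents from [0] to [n] sweep exactly the upper half circle, along
    which the real part strictly decreases: real parts alone separate these
    powers. *)
Lemma cexp_pi_div_inj (R : realType) (n : nat) : (0 < n)%N ->
  {in [pred m | (m <= n)%N] &,
    injective (fun m => cexp (0 +i* (pi / n%:R) : R[i]) ^+ m)}.
Proof.
move=> n_gt0 m k; rewrite !inE => m_le_n k_le_n; rewrite !cexpi_expr.
have step_gt0 : 0 < pi / n%:R :> R.
  by rewrite divr_gt0 ?pi_gt0 ?ltr0n.
have angle_itv (l : nat) : (l <= n)%N -> (pi / n%:R) *+ l \in `[0, pi : R].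
  move=> l_le_n; rewrite in_itv /= mulrn_wge0 ?(ltW step_gt0) //=.
  rewrite -{2}[pi](@divfK _ n%:R) ?pnatr_eq0 -?lt0n //.
  by rewrite mulr_natr ler_pMn2l.
case=> /(cos_inj (angle_itv m m_le_n) (angle_itv k k_le_n)) angle_eq _.
exact: mulrIn (lt0r_neq0 step_gt0) _ _ angle_eq.
Qed.

Lemma cexp_pi_div_expr (R : realType) (n : nat) : (0 < n)%N ->
  cexp (0 +i* (pi / n%:R) : R[i]) ^+ (2 * n) = 1.
Proof.
move=> n_gt0; rewrite cexpi_expr mulnC mulrnA -(mulr_natr (pi / _)) divfK.
  by rewrite cos2pi sin2pi.
by rewrite pnatr_eq0 -lt0n.
Qed.

Theorem proposition6p6 (R : realType) (P : {poly R[i]}) (n : nat)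
    (n_gt0 : (0 < n)%N) (degP : (size P <= n.+1)%N)
    (z0 z : R[i]) (z_neq0 : z != 0) (j : nat) (j_le_n : (j <= n)%N) :
  let omega : R[i] := cexp (0 +i* (pi / n%:R)) in
  let zeta (k : nat) : R[i] := z0 + z * omega ^+ k in
  P^`(j).[z0] / (j`!)%:R =
    1 / (2 * n)%:R * \sum_(0 <= k < 2 * n) P.[zeta k] / (zeta k - z0) ^+ j.
Proof.
move=> omega zeta.
have natC_neq0 l : (0 < l)%N -> l%:R != 0 :> R[i].
  by rewrite pnatr_eq0 lt0n.
have N_neq0 : (2 * n)%:R != 0 :> R[i] by rewrite natC_neq0 // muln_gt0.
rewrite nderivn_def hornerMn -mulr_natr mulfK ?natC_neq0 ?fact_gt0 //.
rewrite (nderivn_root_of_unity_avg z0 N_neq0 (cexp_pi_div_expr _ n_gt0)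
  (cexp_pi_div_inj n_gt0) degP z_neq0 j_le_n).
rewrite div1r big_mkord; congr (_ * _); apply: eq_bigr => k _.
by rewrite /zeta [z0 + _ - z0]addrC addKr.
Qed.
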